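(* There is an absolute constant $K>0$ such that for every positive integer $n$ and every real $\theta$ with $1\le\theta\le\log n$, with probability at least $1-K\theta^{-1/3}$ the uniformly random permutation $\sigma\in\mathcal{S}_n$ satisfies \[ |\log D_j(\sigma)-j|<3\sqrt{j\log j}\qquad\text{for all integers } j \text{ with } \theta\le j\le C(\sigma). \]
   Context: $\mathcal{S}_n$ is the symmetric group on $\{1,\ldots,n\}$. $C(\sigma)$ is the total number of cycles of $\sigma$ (fixed points count as cycles of length 1). For $1\le j\le C(\sigma)$, $D_j(\sigma)$ is the length of the $j$-th smallest cycle of $\sigma$, i.e. the $j$-th term when the cycle lengths of $\sigma$ are listed in nondecreasing order with multiplicity (so $D_j(\sigma)=D_{j+1}(\sigma)$ is possible). *)

(* Defs.v *)
From HB Require Import structures.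
From mathcomp Require Import all_boot all_order all_algebra all_fingroup.
From mathcomp Require Import all_classical all_reals all_analysis.
Set Implicit Arguments.
Unset Strict Implicit.
Unset Printing Implicit Defensive.
Import Order.TTheory GRing.Theory Num.Theory.
Local Open Scope ring_scope.

Definition num_cycles (n : nat) (s : 'S_n) : nat := #|porbits s|.

Definition cycle_lengths (n : nat) (s : 'S_n) : seq nat :=
  sort leq [seq #|A| | A : {set 'I_n} <- enum (porbits s)].

(* The index j starts at 1; outside 1 <= j <= num_cycles s the value is not
   meaningful. *)
Definition cycle_length (n : nat) (s : 'S_n) (j : nat) : nat :=
  nth 0%N (cycle_lengths s) j.-1.

Definition perm_prob (R : realType) (n : nat) (E : set 'S_n) : R :=
  #|[set s : 'S_n | `[< E s >]]%SET|%:R / #|{: 'S_n}|%:R.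

Lemma size_cycle_lengths (n : nat) (s : 'S_n) :
  size (cycle_lengths s) = num_cycles s.
Proof. by rewrite size_sort size_map -cardE. Qed.

(* Main.v *)
Require Import Defs.
From HB Require Import structures.
From mathcomp Require Import all_boot all_order all_algebra all_fingroup.
From mathcomp Require Import all_classical all_reals all_analysis.
From mathcomp Require Import ring lra zify.
Set Implicit Arguments.
Unset Strict Implicit.
Unset Printing Implicit Defensive.
Import Order.TTheory GRing.Theory Num.Theory.
Local Open Scope ring_scope.

(** The number of cycles of length at most [M] of a random permutation behaves
    like a Poisson variable whose parameter is the harmonic sum of [M], which is
    [ln M] up to a bounded error. Since [D_j <= M] holds exactly when there are
    at least [j] cycles of length at most [M], the event that [ln D_j] deviates
    from [j] by [r = 3 * sqrt (j * ln j)] or more is an event that such a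
    variable deviates from its mean by about [r]. Its probability is at most of
    order [expR (- r ^+ 2 / (4 * j)) = j ^- (9 / 4)] by Chernoff's bound
    ([perm_prob_deviates_le]), and a union bound over [j >= theta] gives a total
    of order [theta^-1], which is stronger than [theta ^- (1 / 3)]. Bounded
    values of [theta] are absorbed by the constant.

    Chernoff's bound needs the mean [a_n], over permutations of [n] points, of a
    product of weights [w_k] over the cycles, [k] being the length. Removing a
    point from its cycle yields a recursion ([rooted_weight_remove]) that
    unrolls to [n a_n = \sum_k w_k a_(n-k)] ([mean_weight_rec]). This is the
    recurrence for the coefficients of [exp (\sum_k w_k u^k / k)], whence
    [\sum_(i <= N) a_i <= expR (\sum_(k <= N) w_k / k)] ([sum_le_expR]).
    Inserting this bound into the right-hand side of the recurrence bounds
    [a_n] itself; with [w_k = z] for [k <= M] and [w_k = 1] for [k > M], it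
    loses only a constant factor against the Poisson moment generating function
    ([mean_short_weight_le]), whether [z] is above or below [1]. *)

(** * Weighted sums over permutations *)

Section CycleWeight.
Variables (T : finType) (R : comNzRingType) (w : nat -> R).
Implicit Types (S A : {set T}) (s t : {perm T}) (x y z : T).

Lemma porbit_stable s A z :
  z \in A -> (forall u, u \in A -> s u \in A) -> porbit s z \subset A.
Proof.
move=> zA sA; apply/fintype.subsetP => u /porbitP[i ->].
elim: i => [|i IHi]; first by rewrite expg0 perm1.
by rewrite expgSr permM; apply: sA.
Qed.

Lemma porbit_stepE s x y : (s y \in porbit s x) = (y \in porbit s x).
Proof.
by rewrite -!eq_porbit_mem; have := porbit_perm s 1 y; rewrite expg1 => ->.
Qed.

(** Agreement on a single orbit forces equal powers along it, so that orbit is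
    common to both permutations. *)
Lemma eq_in_porbit s t z :
  {in porbit s z, s =1 t} -> porbit t z = porbit s z.
Proof.
move=> st; have powE i : (t ^+ i)%g z = (s ^+ i)%g z.
  elim: i => [|i IHi]; first by rewrite !expg0.
  by rewrite !expgSr !permM IHi st// mem_porbit.
apply/finset.setP => u.
by apply/porbitP/porbitP => -[i ->]; exists i; rewrite powE.
Qed.

Lemma porbit_mul_tperm_avoid s x y z :
  x \notin porbit s z -> y \notin porbit s z ->
  porbit (s * tperm x y)%g z = porbit s z.
Proof.
move=> xz yz; apply: eq_in_porbit => u uz.
have suz : s u \in porbit s z by rewrite porbit_stepE.
by rewrite permM tpermD//; apply/eqP => E; move: suz; rewrite -E; apply/negP.
Qed.

(** Multiplying by [tperm x y] splices the fixed point [x] into the cycle of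
    [y], just before [y]: both sides are stable under the product, and the
    orbit of [x] reaches [y] in one step. *)
Lemma porbit_insert s x y : s x = x -> y != x ->
  porbit (s * tperm x y)%g x = x |: porbit s y.
Proof.
move=> sx neq; set t := (s * tperm x y)%g.
have tx : t x = y by rewrite permM sx tpermL.
apply/eqP; rewrite finset.eqEsubset; apply/andP; split.
  apply: porbit_stable => [|u]; first by rewrite setU11.
  case/setU1P => [->|uy]; first by rewrite tx setU1r// porbit_id.
  rewrite permM; case: tpermP => [//||_ _].
  - by move=> _; rewrite setU1r// porbit_id.
  - by rewrite setU11.
  - by rewrite setU1r// porbit_stepE.
have yt : y \in porbit t x by rewrite -tx porbit_stepE porbit_id.
rewrite finset.subUset finset.sub1set porbit_id /=.
apply: porbit_stable => // u ut.
have: t u \in porbit t x by rewrite porbit_stepE.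
by rewrite permM; case: tpermP => [->|->|] //; rewrite porbit_id.
Qed.

Lemma porbit_fixed s x : s x = x -> porbit s x = [set x].
Proof.
move=> sx; apply/eqP; rewrite finset.eqEsubset finset.sub1set porbit_id andbT.
by apply: porbit_stable => [|u]; rewrite !inE// => /eqP->; rewrite sx.
Qed.

(** The splice leaves every other cycle alone; [tperm x y] being an
    involution, the argument applies in both directions. *)
Lemma porbits_mul_tperm_avoid s x y A : x \notin A -> y \notin A ->
  (A \in porbits (s * tperm x y)%g) = (A \in porbits s).
Proof.
move=> xA yA; apply/imsetP/imsetP => -[z _ Az]; exists z => //; last first.
  by rewrite porbit_mul_tperm_avoid// -Az.
have -> : s = (s * tperm x y * tperm x y)%g by rewrite -mulgA tperm2 mulg1.
by rewrite porbit_mul_tperm_avoid// -Az.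
Qed.

(** The weight is relative to a set [S] so that points fixed outside [S] do not
    count as cycles: a permutation of [S] is encoded as a permutation of the
    whole type with support in [S]. *)
Definition cycle_weight S s : R :=
  \prod_(A in porbits s | A \subset S) w #|A|.

Definition total_weight S : R := \sum_(s | perm_on S s) cycle_weight S s.

(** The cycle of the root [x] is weighted as if it were [k] longer than it is:
    [k] records how many points have already been removed from it. *)
Definition rooted_weight S x k : R :=
  \sum_(s | perm_on S s) w (k + #|porbit s x|) * cycle_weight (S :\ x) s.

Lemma total_rootedE S x : x \in S -> total_weight S = rooted_weight S x 0.
Proof.
move=> xS; apply: eq_bigr => s sS.
rewrite /cycle_weight (bigD1 (porbit s x)) /=; last first.
  rewrite imset_f//=; apply: porbit_stable => // u uS.
  by rewrite perm_closed.
congr (_ * _); apply: eq_bigl => A; rewrite -andbA.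
case: (boolP (A \in porbits s)) => //= /imsetP[z _ ->].
by rewrite subsetD1 eq_porbit_mem porbit_sym.
Qed.

(** Removing [x] from its cycle is a bijection: a permutation of [S] is
    determined by the image [y] of [x] and by the permutation of [S :\ x] that
    skips over [x]. *)
Lemma big_perm_on_remove S x (f : {perm T} -> R) : x \in S ->
  \sum_(s | perm_on S s) f s =
  \sum_(y in S) \sum_(s | perm_on (S :\ x) s) f (s * tperm x y)%g.
Proof.
move=> xS.
rewrite (partition_big (fun s : {perm T} => s x) (mem S)) /=; last first.
  by move=> s sS; rewrite perm_closed.
apply: eq_bigr => y yS.
rewrite (reindex_inj (mulIg (tperm x y))) /=; apply: eq_bigl => s.
have tS : perm_on S (tperm x y).
  apply: fintype.subset_trans (tperm_on x y) _.
  by apply/fintype.subsetP => u /set2P[] ->.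
have -> : perm_on S (s * tperm x y)%g = perm_on S s.
  apply/idP/idP => [|sS]; last exact: perm_onM.
  by move=> /perm_onM/(_ tS); rewrite -mulgA tperm2 mulg1.
rewrite permM (can2_eq (tpermK x y) (tpermK x y)) tpermR.
apply/andP/idP => [[/fintype.subsetP sS /eqP sx]|/fintype.subsetP sS].
  apply/fintype.subsetP => u us; rewrite in_setD1 (sS u us) andbT.
  by apply: contraTneq us => ->; rewrite inE sx eqxx.
split; first by apply/fintype.subsetP => u /sS; case/setD1P.
by apply: contraT => us; have := sS x us; rewrite !inE eqxx.
Qed.

(** Either [x] is a fixed point, and its cycle is complete with final length
    [k.+1], or the removal of [x] leaves a cycle rooted at the image [y] of
    [x], with one more point on record. *)
Lemma rooted_weight_remove S x k : x \in S ->
  rooted_weight S x k = w k.+1 * total_weight (S :\ x) +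
    \sum_(y in S :\ x) rooted_weight (S :\ x) y k.+1.
Proof.
move=> xS; rewrite /rooted_weight (big_perm_on_remove _ xS) (bigD1 x)//=.
congr (_ + _).
  rewrite /total_weight big_distrr /=; apply: eq_bigr => s sS.
  rewrite tperm1 mulg1.
  have sx : s x = x by rewrite (out_perm sS)// !inE eqxx.
  by rewrite porbit_fixed// cards1 addn1.
apply: eq_big => [y|y /andP[yS yx]]; first by rewrite !inE andbC.
apply: eq_bigr => s sS.
have sx : s x = x by rewrite (out_perm sS)// !inE eqxx.
have xNy : x \notin porbit s y by rewrite porbit_sym porbit_fixed// inE.
rewrite porbit_insert// cardsU1 xNy addnA addn1; congr (_ * _).
rewrite /cycle_weight; apply: eq_bigl => A.
case: (boolP (x \in A)) => [xA|xA].
  by rewrite !subsetD1 xA /= !andbF.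
case: (boolP (y \in A)) => [yA|yA]; last first.
  by rewrite porbits_mul_tperm_avoid// !subsetD1 xA yA !andbT.
rewrite [in RHS]subsetD1 yA !andbF; apply/negP => /andP[/imsetP[z _ Az] _].
have tx : (s * tperm x y)%g x = y by rewrite permM sx tpermL.
move: yA xA; rewrite Az -{1}tx.
by rewrite porbit_stepE => ->.
Qed.

(** The value of [rooted_weight S x k] when [S] has [n] points, and of
    [total_weight S] when [k = 0]; the value [1] at [n = 0] is the weight of
    the empty permutation. *)
Fixpoint rooted_total n k : R :=
  if n is m.+1 then w k.+1 * rooted_total m 0 + m%:R * rooted_total m k.+1
  else 1.

Lemma rooted_totalS n k : rooted_total n.+1 k =
  w k.+1 * rooted_total n 0 + n%:R * rooted_total n k.+1.
Proof. by []. Qed.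

Lemma weights_card n S : #|S| = n ->
  total_weight S = rooted_total n 0 /\
  (forall x k, x \in S -> rooted_weight S x k = rooted_total n k).
Proof.
elim: n S => [|n IHn] S cardS.
  have S0 : S = finset.set0 by apply/eqP; rewrite -cards_eq0 cardS.
  split=> [|x k]; last by rewrite S0 inE.
  rewrite /total_weight (big_pred1 1%g) /= => [|s].
    rewrite /cycle_weight big_pred0// => A.
    rewrite S0 finset.subset0; apply/andP => -[/imsetP[x _ ->] /eqP E].
    by have := porbit_id 1 x; rewrite E inE.
  apply/idP/eqP => [sS|->]; last exact: perm_on1.
  by apply: perm_on_id sS _; rewrite cardS.
have rooted x k : x \in S -> rooted_weight S x k = rooted_total n.+1 k.
  move=> xS; have cardSx : #|S :\ x| = n.
    by move: cardS; rewrite (cardsD1 x) xS => -[].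
  have [tot root] := IHn _ cardSx.
  rewrite rooted_weight_remove// tot /=; congr (_ + _).
  rewrite (eq_bigr (fun=> rooted_total n k.+1)) => [|y]; last exact: root.
  by rewrite sumr_const cardSx mulr_natl.
split=> //; have /card_gt0P[x xS] : (0 < #|S|)%N by rewrite cardS.
by rewrite (total_rootedE xS) rooted.
Qed.

Lemma sum_cycle_weight n : #|T| = n ->
  \sum_(s : {perm T}) \prod_(A in porbits s) w #|A| = rooted_total n 0.
Proof.
move=> cardT; have [<- _] := weights_card (etrans (cardsT T) cardT).
apply: eq_big => [s|s _]; last first.
  by apply: eq_bigl => A; rewrite finset.subsetT andbT.
by apply/esym/fintype.subsetP => u _; rewrite inE.
Qed.

End CycleWeight.

Section WeightRecursion.
Variables (R : numFieldType) (w : nat -> R).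

(** By [sum_cycle_weight], the mean over all permutations of [n] points of the
    product of the weights of their cycles. *)
Definition mean_weight n : R := rooted_total w n 0 / n`!%:R.

(** Unrolls the removal recursion: the root cycle closes after [i.+1] removals,
    and the remaining [n - i] points carry an arbitrary permutation. *)
Lemma rooted_totalE n k :
  rooted_total w n.+1 k / n`!%:R =
  \sum_(i < n.+1) w (k + i.+1)%N * mean_weight (n - i).
Proof.
elim: n k => [|n IHn] k.
  by rewrite big_ord1 /mean_weight /= mul0r addr0 fact0 !divr1 addn1.
rewrite big_ord_recl subn0 addn1 rooted_totalS mulrDl -mulrA; congr (_ + _).
under eq_bigr do rewrite lift0 subSS addnS -addSn.
by rewrite -IHn factS natrM invfM mulrACA mulfV ?pnatr_eq0// mul1r.
Qed.

(** The recurrence [n a_n = \sum_k w_k a_(n-k)] of the coefficients of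
    [exp (\sum_k w_k u^k / k)]: the generating function of mean weights,
    without any series. *)
Lemma mean_weight_rec n :
  n.+1%:R * mean_weight n.+1 = \sum_(i < n.+1) w i.+1 * mean_weight (n - i).
Proof.
have := rooted_totalE n 0; rewrite /= => <-.
by rewrite /mean_weight factS natrM invfM mulrCA mulVKf ?pnatr_eq0//.
Qed.

End WeightRecursion.

(** * The exponential formula as an inequality *)

Section ExpFormula.
Variable R : realType.

Definition exp_poly (p : {poly R}) n : {poly R} :=
  \sum_(i < n) i`!%:R^-1 *: p ^+ i.

(** The truncated form of [(exp p)' = p' exp p]. *)
Lemma deriv_exp_poly p n : (exp_poly p n.+1)^`() = p^`() * exp_poly p n.
Proof.
rewrite /exp_poly big_ord_recl expr0 derivD derivZ derivC scaler0 add0r.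
rewrite raddf_sum big_distrr /=; apply: eq_bigr => i _.
rewrite derivZ deriv_exp /= /bump add1n.
rewrite -scalerAr -[_ *+ i.+1]scaler_nat scalerA.
by rewrite factS natrM invfM mulrC mulVKf// pnatr_eq0.
Qed.

(** Without constant term, [p ^+ n] only has monomials of degree at least [n],
    so the truncation order does not affect the lower coefficients. *)
Lemma coef_exp_poly (p : {poly R}) n k : p`_0 = 0 -> (k < n)%N ->
  (exp_poly p n.+1)`_k = (exp_poly p n)`_k.
Proof.
move=> p0 kn; rewrite /exp_poly big_ord_recr /= coefD coefZ.
have -> : p = drop_poly 1 p * 'X.
  rewrite -['X]expr1 -[LHS](poly_take_drop 1) /take_poly.
  by rewrite poly_def big_ord1 p0 scale0r add0r.
by rewrite exprMn coefMXn kn mulr0 addr0.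
Qed.

Lemma horner_exp_poly_le p n : 0 <= p.[1] -> (exp_poly p n).[1] <= expR p.[1].
Proof.
move=> p_ge0; have -> : (exp_poly p n).[1] = series (exp_coeff p.[1]) n.
  rewrite /exp_poly horner_sum /series /= big_mkord; apply: eq_bigr => i _.
  by rewrite hornerZ horner_exp mulrC.
apply: nondecreasing_cvgn_le; last exact: is_cvg_series_exp_coeff.
apply/nondecreasing_seqP => m; rewrite seriesSr lerDl.
by rewrite divr_ge0// exprn_ge0.
Qed.

(** With [p = \sum_(k <= N) w_k 'X^k / k], the numbers [a_k] are the
    coefficients of [exp p] up to degree [N], because comparing coefficients
    in [(exp p)' = p' exp p] gives the same recurrence. All coefficients being
    nonnegative, their partial sum is at most the value [exp p.[1]]. *)
Lemma sum_le_expR (a w : nat -> R) N :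
  a 0%N = 1 -> (forall k, 0 <= w k) ->
  (forall n, n.+1%:R * a n.+1 = \sum_(i < n.+1) w i.+1 * a (n - i)%N) ->
  \sum_(i < N.+1) a i <= expR (\sum_(i < N) w i.+1 / i.+1%:R).
Proof.
move=> a0 w_ge0 a_rec.
pose p : {poly R} := \poly_(i < N.+1) (w i / i%:R).
have p0 : p`_0 = 0 by rewrite coef_poly mulrC invr0 mul0r.
have p_deriv i : (i < N)%N -> p^`()`_i = w i.+1.
  move=> iN; rewrite coef_deriv coef_poly ltnS iN /=.
  by rewrite -[_ *+ i.+1]mulr_natr mulfVK// pnatr_eq0.
have p1 : p.[1] = \sum_(i < N) w i.+1 / i.+1%:R.
  rewrite horner_poly big_ord_recl /= invr0 mulr0 mul0r add0r.
  by apply: eq_bigr => i _; rewrite expr1n mulr1.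
have aE k : (k <= N)%N -> a k = (exp_poly p N.+1)`_k.
  elim/ltn_ind: k => -[_ _|k IHk kN].
    rewrite a0 /exp_poly big_ord_recl expr0 fact0 invr1 scale1r coefD.
    rewrite coef1 coef_sum.
    rewrite big1 ?addr0// => i _.
    by rewrite coefZ lift0 exprS coef0M p0 mul0r mulr0.
  apply: (@mulfI _ k.+1%:R); first by rewrite pnatr_eq0.
  rewrite [RHS]mulr_natl -coef_deriv deriv_exp_poly coefM a_rec.
  apply: eq_bigr => i _.
  have ik : (i <= k)%N by rewrite -ltnS.
  rewrite p_deriv; last exact: leq_ltn_trans kN.
  rewrite IHk ?(leq_ltn_trans (leq_subr _ _))//;
    last by rewrite (leq_trans (leq_subr _ _))// ltnW.
  by rewrite coef_exp_poly// (leq_ltn_trans (leq_subr _ _)).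
rewrite -p1; have coef_ge0 M k : 0 <= (exp_poly p M)`_k.
  suff exp_ge0 i : forall l, 0 <= (p ^+ i)`_l.
    by rewrite coef_sum sumr_ge0// => i _; rewrite coefZ mulr_ge0// invr_ge0.
  elim: i => [|i IHi] l; first by rewrite expr0 coef1.
  rewrite exprS coefM sumr_ge0// => m _; rewrite mulr_ge0// coef_poly.
  by case: ifP => // _; rewrite divr_ge0.
have p1_ge0 : 0 <= p.[1] by rewrite p1 sumr_ge0// => i _; rewrite divr_ge0.
apply: le_trans (horner_exp_poly_le N.+1 p1_ge0).
rewrite (@horner_coef_wide _ (maxn N.+1 (size (exp_poly p N.+1)))) ?leq_maxr//.
rewrite -(subnKC (leq_maxl N.+1 (size (exp_poly p N.+1)))) big_split_ord /=.
rewrite -[leLHS]addr0 lerD//; last first.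
  by rewrite sumr_ge0// => i _; rewrite expr1n mulr1.
by apply: ler_sum => i _; rewrite expr1n mulr1 aE// -ltnS.
Qed.
End ExpFormula.

(** * The number of short cycles *)

Section Harm.
Variable R : realType.

Definition harm n : R := \sum_(i < n) i.+1%:R^-1.

Lemma harmS n : harm n.+1 = harm n + n.+1%:R^-1.
Proof. by rewrite /harm big_ord_recr. Qed.

Lemma harm_mono m n : (m <= n)%N -> harm m <= harm n.
Proof.
elim: n => [|n IHn]; first by rewrite leqn0 => /eqP->.
rewrite leq_eqVlt => /orP[/eqP->//|mn].
by apply: le_trans (IHn mn) _; rewrite harmS lerDl invr_ge0.
Qed.

Lemma harm_le n : harm n.+1 <= 1 + ln n.+1%:R.
Proof.
elim: n => [|n IHn]; first by
  rewrite harmS /harm big_ord0 add0r invr1 ln1 addr0.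
rewrite harmS; set x : R := n.+2%:R^-1.
have x_gt0 : 0 < x by rewrite invr_gt0 ltr0n.
have x_lt1 : x < 1 by rewrite invf_lt1 ?ltr1n// ltr0n.
have E : n.+1%:R = n.+2%:R * (1 - x) :> R.
  by rewrite mulrBr mulr1 mulfV ?pnatr_eq0// -[n.+2]addn1 natrD addrK.
have : ln (1 - x) <= - x by apply: le_ln1Dx; lra.
move: IHn; rewrite E lnM ?posrE ?ltr0n ?subr_gt0//; lra.
Qed.

Lemma harm_ge n : ln n.+1%:R <= harm n.
Proof.
elim: n => [|n IHn]; first by rewrite /harm big_ord0 ln1.
rewrite harmS; set x : R := n.+1%:R^-1.
have x_gt0 : 0 < x by rewrite invr_gt0 ltr0n.
have E : n.+2%:R = n.+1%:R * (1 + x) :> R.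
  by rewrite mulrDr mulr1 mulfV ?pnatr_eq0// natr1.
have : ln (1 + x) <= x by apply: le_ln1Dx; lra.
rewrite E lnM ?posrE ?ltr0n ?addr_gt0//; lra.
Qed.

(** With this weight the product over the cycles of a permutation is [z] to
    the number of its cycles of length at most [M]. *)
Definition short_weight (M : nat) (z : R) k := if (k <= M)%N then z else 1.

Lemma sum_short_weight M z n :
  \sum_(i < n) short_weight M z i.+1 / i.+1%:R =
  harm n + (z - 1) * harm (minn M n).
Proof.
elim: n => [|n IHn]; first by rewrite minn0 /harm !big_ord0 mulr0 addr0.
rewrite big_ord_recr IHn /= /short_weight harmS; case: (ltnP n M) => Mn.
  by rewrite (minn_idPr Mn) harmS; ring.
by rewrite mul1r (minn_idPl (leqW Mn)); ring.
Qed.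

Lemma mean_weight_ge0 (w : nat -> R) n :
  (forall k, 0 <= w k) -> 0 <= mean_weight w n.
Proof.
move=> w_ge0; rewrite /mean_weight divr_ge0//.
by elim: n 0%N => [|n IHn] k //=; rewrite addr_ge0// mulr_ge0.
Qed.

(** Bounding the factors [w_k] of the recurrence by [expR 1] gives
    [n.+1 * a_(n.+1) <= expR 1 * \sum_(i <= n) a_i], and the sum is at most
    [expR (harm n + ...)] by [sum_le_expR]. As [harm n <= 1 + ln n.+1], the
    factor [n.+1] cancels; what is left is, up to the constant [expR 2], the
    moment generating function of a Poisson variable of parameter
    [harm (minn M n)]. *)
Lemma mean_short_weight_le M t n : t <= 1 ->
  mean_weight (short_weight M (expR t)) n.+1 <=
  expR (2 + (expR t - 1) * harm (minn M n)).
Proof.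
move=> t1; set w := short_weight M _.
have w_ge0 k : 0 <= w k.
  by rewrite /w /short_weight; case: ifP; rewrite ?expR_ge0.
have w_le k : w k <= expR 1.
  rewrite /w /short_weight; case: ifP => _; rewrite ?ler_expR//.
  by rewrite -[leLHS]expR0 ler_expR.
rewrite -(ler_pM2l (ltr0Sn R n)) mean_weight_rec.
apply: (@le_trans _ _ (expR 1 * \sum_(i < n.+1) mean_weight w i)).
  rewrite big_distrr/= [leRHS](reindex_inj rev_ord_inj)/=.
  by apply: ler_sum => i _; rewrite subSS ler_wpM2r// mean_weight_ge0.
have a0 : mean_weight w 0 = 1 by rewrite /mean_weight /= fact0 divr1.
have := sum_le_expR n a0 w_ge0 (mean_weight_rec w).
rewrite sum_short_weight => le_exp.
apply: (@le_trans _ _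
    (expR 1 * expR (harm n + (expR t - 1) * harm (minn M n)))).
  by rewrite ler_pM2l ?expR_gt0.
rewrite -[X in _ <= X * _]lnK ?posrE ?ltr0n// -!expRD ler_expR.
suff : harm n <= harm n.+1 by have := harm_le n; lra.
by rewrite harmS lerDl invr_ge0.
Qed.

End Harm.

Section Sorted.
Implicit Types (l : seq nat) (M j : nat).

Lemma sorted_nth_le_count l M j : sorted leq l -> (j < size l)%N ->
  (nth 0 l j <= M)%N -> (j < count (fun k => k <= M) l)%N.
Proof.
move=> l_sorted jl nthM; rewrite -(cat_take_drop j.+1 l) count_cat.
rewrite (_ : count _ (take _ _) = j.+1) ?leq_addr//.
rewrite -[RHS](size_takel jl); apply/eqP.
rewrite -all_count; apply/(all_nthP 0).
move=> i; rewrite size_takel// => ij; rewrite nth_take//; apply: leq_trans nthM.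
rewrite (sorted_leq_nth leq_trans leqnn)// ?inE//.
exact: leq_trans jl.
Qed.

Lemma sorted_nth_gt_count l M j : sorted leq l ->
  (j < size l)%N -> (M < nth 0 l j)%N -> (count (fun k => k <= M) l <= j)%N.
Proof.
move=> l_sorted jl nthM; rewrite -(cat_take_drop j l) count_cat.
rewrite (_ : count _ (drop _ _) = 0%N) ?addn0.
  by apply: leq_trans (count_size _ _) _; rewrite size_take jl.
apply/eqP; rewrite -leqn0 leqNgt -has_count; apply/(has_nthP 0) => -[i].
rewrite size_drop => ij; rewrite nth_drop leqNgt => /negP; apply.
apply: leq_trans nthM _.
by rewrite (sorted_leq_nth leq_trans leqnn) ?inE ?leq_addr// -ltn_subRL.
Qed.
End Sorted.

Section Tail.
Variable R : realType.

Definition short_cycles M n (s : 'S_n) : nat :=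
  count (fun k => k <= M)%N (cycle_lengths s).

Lemma prod_short_weight M z n (s : 'S_n) :
  \prod_(A in porbits s) short_weight M z #|A| = z ^+ short_cycles M s :> R.
Proof.
transitivity (\prod_(k <- cycle_lengths s) short_weight M z k).
  rewrite (perm_big [seq #|A| | A : {set 'I_n} <- enum (porbits s)]) /=;
    last first.
    by rewrite perm_sort.
  by rewrite big_map big_enum.
by rewrite /short_weight -big_mkcond big_const_seq iter_mulr_1.
Qed.

(** Chernoff's bound for the number of short cycles. A positive [t] serves
    for the upper tail, a negative one for the lower tail. *)
Lemma perm_prob_chernoff n (E : set 'S_n.+1) M t (j : nat) : t <= 1 ->
  (forall s, E s -> t * j%:R <= t * (short_cycles M s)%:R) ->
  perm_prob R E <= expR (2 + (expR t - 1) * harm R (minn M n) - t * j%:R).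
Proof.
move=> t1 Et; rewrite expRD expRN ler_pdivlMr ?expR_gt0//.
apply: le_trans (mean_short_weight_le M n t1).
rewrite /mean_weight -(@sum_cycle_weight 'I_n.+1) ?card_ord//.
under eq_bigr do rewrite prod_short_weight.
rewrite /perm_prob card_Sn mulrAC ler_pM2r ?invr_gt0 ?ltr0n ?fact_gt0//.
rewrite mulr_natl -sumr_const big_mkcond /=; apply: ler_sum => s _.
rewrite inE; case: asboolP => [Es|_]; last by rewrite exprn_ge0// expR_ge0.
by rewrite -expRM_natr ler_expR Et.
Qed.

End Tail.

(** * Numerical estimates *)

Section Exponents.
Variable R : realType.
Implicit Types t x h : R.

(** From [expR (- t / 2) >= 1 - t / 2], squared and inverted. *)
Lemma expR_le_quad t : 0 <= t -> t <= 1 / 6 -> expR t <= 1 + t + t ^+ 2.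
Proof.
move=> t0 t1; have /= := expR_ge1Dx (- (t / 2)).
set y := expR _ => hy.
have -> : expR t = (y ^+ 2)^-1.
  by rewrite /y -expRM_natl -expRN; congr expR; field.
have y_gt0 : 0 < y by exact: expR_gt0.
rewrite -[leLHS]mul1r ler_pdivrMr ?exprn_gt0//.
have : (1 - t / 2) ^+ 2 <= y ^+ 2 by rewrite ler_sqr ?nnegrE; lra.
nra.
Qed.

(** From [expR (t / 2) >= 1 + t / 2], squared and inverted. The coefficient
    [3 / 4] below [1] leaves the room that [lower_exponent] needs. *)
Lemma expRN_le_quad t : 0 <= t -> expR (- t) <= 1 - t + 3 / 4 * t ^+ 2.
Proof.
move=> t0; have /= := expR_ge1Dx (t / 2).
set y := expR _ => hy.
have -> : expR (- t) = (y ^+ 2)^-1.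
  by rewrite /y -expRM_natl -expRN; congr expR; field.
have y_gt0 : 0 < y by exact: expR_gt0.
rewrite -[leLHS]mul1r ler_pdivrMr ?exprn_gt0//.
have : (1 + t / 2) ^+ 2 <= y ^+ 2 by rewrite ler_sqr ?nnegrE; lra.
nra.
Qed.

(** For a deviation [r = 2 t x] from [x] the choice of [t] is the optimal one
    to first order, and [t ^+ 2 * x = r ^+ 2 / (4 x)] is the resulting decay;
    the additive [1] absorbs the bounded error in the harmonic sum [h]. *)
Lemma upper_exponent t x h : 0 <= t -> t <= 1 / 6 -> 0 <= x ->
  h <= 1 + x - 2 * t * x ->
  (expR t - 1) * h - t * x <= 1 - t ^+ 2 * x.
Proof.
move=> t0 t1 x0 hh; have e1 := expR_le_quad t0 t1.
have e0 : 0 <= expR t - 1 by have := expR_ge1Dx t; lra.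
have xt : 0 <= 1 + x - 2 * t * x by nra.
apply: (@le_trans _ _ ((t + t ^+ 2) * (1 + x - 2 * t * x) - t * x)).
  rewrite lerD2r; apply: le_trans (ler_wpM2l e0 hh) _.
  by rewrite ler_wpM2r//; lra.
have : 0 <= t ^+ 3 * x by rewrite mulr_ge0// exprn_ge0.
nra.
Qed.

Lemma lower_exponent t x h : 0 <= t -> t <= 1 / 6 -> 1 <= x ->
  x + 2 * t * x - 1 <= h ->
  (expR (- t) - 1) * h + t * x <= 1 - t ^+ 2 * x.
Proof.
move=> t0 t1 x0 hh; have e1 := expRN_le_quad t0.
have e0 : expR (- t) - 1 <= 0 by rewrite subr_le0 expR_le1; lra.
have xt : 0 <= x + 2 * t * x - 1 by nra.
apply: (@le_trans _ _ ((- t + 3 / 4 * t ^+ 2) * (x + 2 * t * x - 1) + t * x)).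
  rewrite lerD2r; apply: le_trans (ler_wnM2l e0 hh) _.
  by rewrite ler_wpM2r//; lra.
have : t * (t ^+ 2 * x) <= 1 / 6 * (t ^+ 2 * x).
  by rewrite ler_wpM2r// mulr_ge0 ?sqr_ge0//; lra.
have : 0 <= t ^+ 2 by rewrite sqr_ge0.
nra.
Qed.

(** From [ln x = 2 * ln (sqrt x) < 2 * sqrt x]. *)
Lemma ln_le_div81 x : 162 ^+ 2 <= x -> ln x <= x / 81.
Proof.
move=> hx; have x0 : 0 <= x by lra.
have s_ge : 162 <= Num.sqrt x.
  by rewrite -ler_sqr ?nnegrE ?sqrtr_ge0// sqr_sqrtr.
move: s_ge; rewrite -[in ln x](sqr_sqrtr x0) -[in x / _](sqr_sqrtr x0).
set y := Num.sqrt x => y_ge; have y_gt0 : 0 < y by lra.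
have := ln_sublinear y_gt0; rewrite lnXn// mulr2n; nra.
Qed.

(** The partial sums telescope, since [N^-2 <= (N - 1)^-1 - N^-1]. *)
Lemma sum_inv_sqr_le (theta : R) N : 2 <= theta ->
  \sum_(j < N) (if theta <= j%:R then j%:R ^- 2 else 0) <= 2 / theta.
Proof.
move=> th2; set d := theta - 1; have d_gt0 : 0 < d by rewrite /d; lra.
(* for [N < theta] the sum is empty, whereas the telescoped difference is only
   nonnegative from [N >= theta] on *)
suff H : \sum_(j < N) (if theta <= j%:R then j%:R ^- 2 else 0) <=
  if theta <= N%:R then d^-1 - (N%:R - 1)^-1 else 0.
  apply: le_trans H _; have d_le : d^-1 <= 2 / theta.
    by rewrite ler_pdivlMr ?ler_pdivrMl//; rewrite /d; lra.
  case: ifP => thN; last by rewrite divr_ge0//; lra.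
  have : 0 <= (N%:R - 1 : R)^-1 by rewrite invr_ge0; lra.
  lra.
elim: N => [|N IHN]; first by rewrite big_ord0 ifF//; lra.
rewrite big_ord_recr /=; move: IHN; set S := \sum_(j < N) _.
rewrite -natr1 addrK; have [thN|thN] := leP theta N%:R => IHN.
  rewrite ifT; last by lra.
  have E : (N%:R : R) ^- 2 <= (N%:R - 1)^-1 - N%:R^-1.
    have -> : (N%:R - 1 : R)^-1 - N%:R^-1 = ((N%:R - 1) * N%:R)^-1.
      by field; apply/andP; split; lra.
    by rewrite lef_pV2 ?posrE ?exprn_gt0 ?mulr_gt0//; nra.
  lra.
rewrite addr0; case: ifP => [thN1|_]; last exact: IHN.
apply: le_trans IHN _; rewrite subr_ge0 lef_pV2 ?posrE; rewrite /d; lra.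
Qed.
End Exponents.

(** * Probabilities of sets of permutations *)

Local Open Scope classical_set_scope.

Section PermProb.
Variables (R : realType) (n : nat).
Implicit Types E F : set 'S_n.

Lemma perm_prob_ge0 E : 0 <= perm_prob R E.
Proof. by rewrite /perm_prob divr_ge0. Qed.

Lemma le_perm_prob E F : E `<=` F -> perm_prob R E <= perm_prob R F.
Proof.
move=> EF; rewrite /perm_prob ler_wpM2r ?invr_ge0// ler_nat subset_leq_card//.
by apply/fintype.subsetP => s; rewrite !inE; exact: EF.
Qed.

Lemma perm_probU E F :
  perm_prob R (E `|` F) <= perm_prob R E + perm_prob R F.
Proof.
rewrite /perm_prob -mulrDl ler_wpM2r ?invr_ge0// -natrD ler_nat.
apply: leq_trans (leq_card_setU _ _); rewrite subset_leq_card//.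
apply/fintype.subsetP => s; rewrite !inE => EFs; apply/orP.
by case: EFs => Es; [left|right]; apply/asboolP.
Qed.

Lemma perm_prob0 : perm_prob R (set0 : set 'S_n) = 0.
Proof.
rewrite /perm_prob (_ : [set s | _]%SET = finset.set0) ?cards0 ?mul0r//.
by apply/finset.setP => s; rewrite !inE; apply/asboolP.
Qed.

Lemma perm_probC E : perm_prob R (~` E) = 1 - perm_prob R E.
Proof.
rewrite /perm_prob.
have -> : [set s | `[< (~` E) s >]]%SET = ~: [set s | `[< E s >]]%SET.
  by apply/finset.setP => s; rewrite !inE asbool_neg.
set A := [set s | _]%SET.
have total_neq0 : #|{: 'S_n}|%:R != 0 :> R.
  by rewrite pnatr_eq0 card_Sn -lt0n fact_gt0.
rewrite -[X in X - _](mulfV total_neq0) -mulrBl; congr (_ / _).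
by rewrite -(cardsC A) natrD addrAC subrr add0r.
Qed.

Lemma perm_prob_exists_le (E : nat -> set 'S_n) N :
  perm_prob R [set s | exists2 j, (j < N)%N & E j s] <=
  \sum_(j < N) perm_prob R (E j).
Proof.
elim: N => [|N IHN].
  rewrite big_ord0 -[leRHS]perm_prob0; apply: le_perm_prob.
  by move=> s [].
rewrite big_ord_recr /=; apply: le_trans (lerD IHN (lexx _)).
apply: le_trans (perm_probU _ _); apply: le_perm_prob => s [j].
rewrite ltnS leq_eqVlt => /orP[/eqP->|jN] Ejs; first by right.
by left; exists j.
Qed.
End PermProb.

(** * Deviations of cycle lengths *)

Section Lengths.
Variables (n : nat) (s : 'S_n).

Lemma num_cycles_le : (num_cycles s <= n)%N.
Proof. by rewrite -[leqRHS]card_ord; apply: leq_imset_card. Qed.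

Lemma cycle_lengths_bounds l : l \in cycle_lengths s -> (0 < l <= n)%N.
Proof.
rewrite mem_sort => /mapP[A]; rewrite mem_enum => /imsetP[i _ ->] ->.
by rewrite lt0n card_porbit_neq0 -[leqRHS]card_ord max_card.
Qed.

Lemma cycle_lengths_sorted : sorted leq (cycle_lengths s).
Proof. exact: (sort_sorted leq_total). Qed.

End Lengths.

Section Deviation.
Variable R : realType.

Definition radius (j : nat) : R := 3 * Num.sqrt (j%:R * ln (j%:R : R)).

Definition deviates n j : set 'S_n := [set s | (j <= num_cycles s)%N /\
  ~ `|ln ((cycle_length s j)%:R : R) - j%:R| < radius j].

(** A [j]-th cycle that is too short means too many short cycles, and one that
    is too long means too few; as its length is at most [n], the latter can
    only happen for a threshold at most [n]. *)
Lemma deviates_sub n j : (0 < j)%N ->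
  @deviates n j `<=`
  [set s | (j <= short_cycles (Num.truncn (expR (j%:R - radius j))) s)%N] `|`
  [set s | expR (j%:R + radius j) <= n%:R /\
     (short_cycles (Num.truncn (expR (j%:R + radius j))).-1 s < j)%N].
Proof.
move=> j_gt0 s [js]; set D := cycle_length s j => /negP; rewrite -leNgt.
have j_size : (j.-1 < size (cycle_lengths s))%N.
  by rewrite size_cycle_lengths prednK.
have /andP[D_gt0 Dn] : (0 < D <= n)%N.
  by apply: cycle_lengths_bounds; apply: mem_nth.
have DR_gt0 : (D%:R : R) \is Num.pos by rewrite posrE ltr0n.
rewrite ler_normr => /orP[far|near]; [right|left].
  have expD : expR (j%:R + radius j) <= D%:R.
    by rewrite -[leRHS]lnK// ler_expR; lra.
  split; first by apply: le_trans expD _; rewrite ler_nat.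
  rewrite -[X in (_ < X)%N](prednK j_gt0) ltnS.
  apply: sorted_nth_gt_count => //; first exact: cycle_lengths_sorted.
  have : (Num.truncn (expR (j%:R + radius j)) <= D)%N.
    by rewrite -(ler_nat R); apply: le_trans expD; rewrite truncn_le expR_ge0.
  by rewrite -/(cycle_length s j) -/D; lia.
rewrite /= -[leqLHS](prednK j_gt0).
apply: sorted_nth_le_count => //; first exact: cycle_lengths_sorted.
rewrite -/(cycle_length s j) -/D truncn_ge_nat ?expR_ge0//.
by rewrite -[leLHS]lnK// ler_expR; lra.
Qed.

(** Both tails are handled with [t = r / (2 j)] for [r = radius j], for which
    [t ^+ 2 * j = 9 / 4 * ln j]: the probabilities are of order [j ^- (9 / 4)].
    The lower bound on [j] makes [r <= j / 3], that is [t <= 1 / 6]. *)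
Lemma perm_prob_deviates_le n j : 162 ^+ 2 <= j%:R :> R ->
  perm_prob R (@deviates n.+1 j) <= 2 * expR 3 * j%:R ^- 2.
Proof.
move=> j_ge; have j_gt0 : (0 < j)%N by rewrite -(ltr0n R); lra.
apply: le_trans (le_perm_prob _ (deviates_sub j_gt0)) _.
apply: le_trans (perm_probU _ _ _) _; rewrite -mulrA mulr2n mulrDl !mul1r.
have r_eq : radius j = 3 * Num.sqrt (j%:R * ln j%:R) by [].
move: (radius j) r_eq => r r_eq.
pose x : R := j%:R; rewrite -/x in j_ge r_eq *.
have x_gt0 : 0 < x by lra.
have ln_ge : 0 <= ln x by apply: ln_ge0; lra.
have ln_le := ln_le_div81 j_ge.
pose t := r / (2 * x).
have rE : r = 2 * t * x by rewrite /t; field; lra.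
have r_ge0 : 0 <= r by rewrite r_eq mulr_ge0// sqrtr_ge0.
have r_sqr : r ^+ 2 = 9 * (x * ln x).
  by rewrite r_eq exprMn sqr_sqrtr; [ring|rewrite mulr_ge0//; lra].
have r_le : r <= x / 3 by rewrite -ler_sqr ?nnegrE ?r_sqr//; [nra|lra].
have t_ge0 : 0 <= t by rewrite divr_ge0//; lra.
have t_le : t <= 1 / 6 by rewrite ler_pdivrMr; lra.
have t_sqr : t ^+ 2 * x = 9 / 4 * ln x.
  by rewrite /t exprMn r_sqr; field; lra.
(* [9 / 4] is weakened to [2]: the exponent only has to exceed [4 / 3] *)
have final : expR (2 + (1 - t ^+ 2 * x)) <= expR 3 * x ^- 2.
  rewrite -[x ^- 2]lnK ?posrE ?invr_gt0 ?exprn_gt0// lnV ?posrE ?exprn_gt0//.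
  by rewrite lnXn// -expRD ler_expR t_sqr mulr2n; lra.
apply: lerD.
  apply: le_trans final.
  set M := Num.truncn _.
  apply: (@le_trans _ _
      (expR (2 + (expR t - 1) * harm R (minn M n) - t * j%:R))).
    apply: perm_prob_chernoff => [|s /= js]; first by lra.
    by rewrite ler_wpM2l// ler_nat.
  rewrite ler_expR -addrA lerD2l; apply: (upper_exponent (x := x)) => //.
  apply: le_trans (harm_mono _ (geq_minl _ _)) _.
  case EM : M => [|m]; first by rewrite /harm big_ord0 -rE; lra.
  apply: le_trans (harm_le _ _) _; rewrite -addrA lerD2l -rE.
  rewrite -[leRHS]expRK ler_ln ?posrE ?ltr0n ?expR_gt0//.
  by rewrite -EM truncn_le expR_ge0.
set y := expR (x + r).
(* too few cycles shorter than [y = expR (j + r)] *)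
have [yn|ny] := leP y n.+1%:R; last first.
  set E := (X in perm_prob R X); have -> : E = set0.
    by rewrite -subset0 => s [].
  by rewrite perm_prob0 mulr_ge0 ?expR_ge0// invr_ge0 exprn_ge0// ltW.
apply: le_trans final; set M := (Num.truncn y).-1.
have y_ge1 : 1 <= y by rewrite -expR0 ler_expR; lra.
have y_ge0 : 0 <= y by rewrite expR_ge0.
have trunc_gt0 : (0 < Num.truncn y)%N by rewrite truncn_ge_nat.
have Mn : (M <= n)%N.
  have : (Num.truncn y <= n.+1)%N.
    by rewrite -(ler_nat R); apply: le_trans yn; rewrite truncn_le.
  by rewrite /M; lia.
apply: (@le_trans _ _
    (expR (2 + (expR (- t) - 1) * harm R (minn M n) - (- t) * j%:R))).
  apply: perm_prob_chernoff => [|s /= [_ js]]; first by lra.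
  by rewrite ler_wnM2l ?oppr_le0// ler_nat ltnW.
rewrite (minn_idPl Mn) ler_expR -addrA lerD2l mulNr opprK.
apply: (lower_exponent (x := x)) => //; first by lra.
apply: le_trans (harm_ge _ _); rewrite /M prednK// -rE.
rewrite -[leLHS]expRK ler_ln ?posrE ?ltr0n ?expR_gt0//.
rewrite expRB ler_pdivrMr ?expR_gt0// -/y.
have /andP[_ y_lt] := truncn_itv y_ge0.
(* rounding [y] down costs at most [1] in the logarithm, as
   [y <= 2 * truncn y <= expR 1 * truncn y] *)
have : 1 + 1 <= expR 1 :> R by exact: expR_ge1Dx.
have : 1 <= (Num.truncn y)%:R :> R by rewrite ler1n.
by move: y_lt; rewrite -natr1; nra.
Qed.

End Deviation.

Theorem theorem1p12 (R : realType) :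
  exists K : R, 0 < K /\
    forall (n : nat) (theta : R),
      (0 < n)%N -> 1 <= theta -> theta <= ln (n%:R : R) ->
      1 - K * theta `^ (- (1 / 3)) <=
        perm_prob R
          [set s : 'S_n | forall j : nat,
             theta <= j%:R -> (j <= num_cycles s)%N ->
             `|ln ((cycle_length s j)%:R : R) - j%:R|
               < 3 * Num.sqrt (j%:R * ln (j%:R : R))].
Proof.
exists (162 ^+ 2 + 4 * expR 3); have e3 := expR_gt0 (3 : R).
split; first by lra.
move=> [//|n] theta _ th1 _.
have pow_ge : theta^-1 <= theta `^ (- (1 / 3)).
  by rewrite -powR_inv1; [apply: ler_powR => //; lra|lra].
have th_gt0 : 0 < theta by lra.
have thV_gt0 : 0 < theta^-1 by rewrite invr_gt0.
set G := [set s | _].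
suff : 1 - perm_prob R G <= (162 ^+ 2 + 4 * expR 3) * theta^-1.
  suff : (162 ^+ 2 + 4 * expR 3) * theta^-1 <=
    (162 ^+ 2 + 4 * expR 3) * theta `^ (- (1 / 3)) by lra.
  by rewrite ler_wpM2l//; lra.
(* for [theta <= 162 ^+ 2] the right-hand side is at least [1] *)
have [th_small|th_large] := leP theta (162 ^+ 2).
  have := perm_prob_ge0 R G.
  have : 1 <= 162 ^+ 2 * theta^-1 by rewrite ler_pdivlMr// mul1r.
  have : 0 <= 4 * expR 3 * theta^-1 by rewrite mulr_ge0//; lra.
  lra.
rewrite -perm_probC.
apply: (@le_trans _ _ (\sum_(j < n.+2)
    perm_prob R [set s | theta <= j%:R /\ @deviates R n.+1 j s])).
  apply: le_trans (perm_prob_exists_le _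
    (fun j => [set s | theta <= j%:R /\ @deviates R n.+1 j s]) _).
  apply: le_perm_prob => s.
  move=> /existsNP[j /not_implyP[thj /not_implyP[js bad]]].
  by exists j; first by rewrite ltnS; apply: leq_trans js (num_cycles_le s).
apply: (@le_trans _ _ (\sum_(j < n.+2)
    2 * expR 3 * (if theta <= j%:R then j%:R ^- 2 else 0))).
  apply: ler_sum => j _; case: (leP theta j%:R) => thj.
    have j_ge : 162 ^+ 2 <= j%:R :> R by lra.
    apply: le_trans (perm_prob_deviates_le n j_ge).
    by apply: le_perm_prob => s [].
  by rewrite mulr0 -(perm_prob0 R n.+1); apply: le_perm_prob => s [].
rewrite -big_distrr /=.
have th2 : 2 <= theta by lra.
have := sum_inv_sqr_le n.+2 th2; set S := \sum_(_ < _) _; nra.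
Qed.
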